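(* Let $M\subset\mathbb{C}^N$ be a formal real hypersurface of $m$-infinite type with $m\ge 2$, and denote by $E$ the exceptional complex hypersurface contained in $M$. Then for every formal holomorphic map $H\colon(\mathbb{C}^N,0)\to(\mathbb{C}^N,0)$ sending $M$ into itself, either $H$ is CR-transversal or $H(\mathbb{C}^N)\subset E$.
   Context: For a formal power series $h(x)$ with complex coefficients, $\bar h(x)$ is the series obtained by conjugating the coefficients (similarly for formal maps). Formal real hypersurface $M\subset\mathbb{C}^N$ (through $0$): given by $r\in\mathbb{C}[[Z,\zeta]]$, $(Z,\zeta)\in\mathbb{C}^N\times\mathbb{C}^N$, with $\bar r(\zeta,Z)=r(Z,\zeta)$, $r(0)=0$ and $\partial_Z r(0)\neq 0$; $\mathcal{I}(M)$ is the ideal of $\mathbb{C}[[Z,\zeta]]$ generated by $r$, and $T^{1,0}_0M=\ker\partial_Zr(0)\subset T_0\mathbb{C}^N$. Normal coordinates: there is a formal change of coordinates $Z=Z(z,w)$ of $\mathbb{C}^N$, $z\in\mathbb{C}^{N-1}$, $w\in\mathbb{C}$, with associated change $\zeta=\bar Z(\chi,\tau)$, $\chi\in\mathbb{C}^{N-1}$, $\tau\in\mathbb{C}$, such that $M$ is defined by $w-Q(z,\chi,\tau)$, where $Q\in\mathbb{C}[[z,\chi,\tau]]$ satisfies $Q(0,\chi,\tau)=Q(z,0,\tau)=\tau$. $m$-infinite type: $M$ is of $m$-infinite type if in normal coordinates $Q(z,\chi,\tau)=\tau+\tau^m\widetilde Q(z,\chi,\tau)$ with $\widetilde Q(z,0,\tau)=\widetilde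 Q(0,\chi,\tau)=0$ and $\widetilde Q(z,\chi,0)\not\equiv0$ (the condition and the integer $m$ do not depend on the choice of normal coordinates). For $m\ge1$ such an $M$ contains a formal complex hypersurface $E$, called the exceptional complex hypersurface, given in normal coordinates by $E=\{w=0\}$. Maps: a formal holomorphic map $H\colon(\mathbb{C}^N,0)\to(\mathbb{C}^N,0)$ sends $M$ (defined by $r$) into itself if $r(H(Z),\bar H(\zeta))\in\mathcal{I}(M)$. $H$ is CR-transversal if $T^{1,0}_0M+dH(T_0\mathbb{C}^N)=T_0\mathbb{C}^N$, where $dH$ is the differential of $H$ at $0$. Writing $H=(F,G)$ in normal coordinates $(z,w)$ for $M$, with $F$ having $N-1$ components and $G$ scalar, $H$ is CR-transversal iff $\partial G/\partial w(0)\neq0$, and $H(\mathbb{C}^N)\subset E$ means $G\equiv0$. *)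

(* Defs.v *)
From HB Require Import structures.
From mathcomp Require Import all_boot all_order all_algebra.
From mathcomp Require Import boolp reals.
From mathcomp Require Export complex.

Set Implicit Arguments.
Unset Strict Implicit.
Unset Printing Implicit Defensive.

Import GRing.Theory.

Local Open Scope ring_scope.

(** * Formal power series in finitely many variables

    The variables are indexed by a finite type [I], so that the power series in
    two groups of variables, such as [(Z, zeta)], are those over a sum type.
    Exponents are elements of the additive monoid [{ffun I -> nat}]. *)

Notation expo I := {ffun I -> nat}.

Definition edeg (I : finType) (a : expo I) : nat := (\sum_i a i)%N.

Definition edelta (I : finType) (i : I) : expo I := [ffun j => (j == i) : nat].

(* The exponents whose entries are at most d: a finite type, used to write sums
   over exponents that have only finitely many relevant terms. *)
Notation bexpo I d := {ffun I -> 'I_d.+1}.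

Definition bval (I : finType) (d : nat) (b : bexpo I d) : expo I :=
  [ffun i => b i : nat].

Record fps (I : finType) (R : Type) := Fps { coef : expo I -> R }.

Lemma fpsP (I : finType) (R : Type) (f g : fps I R) : coef f =1 coef g -> f = g.
Proof. by case: f g => [f] [g] /= /funext ->. Qed.

HB.instance Definition _ (I : finType) (R : Type) := gen_eqMixin (fps I R).
HB.instance Definition _ (I : finType) (R : Type) := gen_choiceMixin (fps I R).

Section BoundedSums.
Variables (I : finType) (R : nmodType).
Implicit Types a : expo I.

Lemma bval_inj d : injective (@bval I d).
Proof.
move=> b b' /ffunP e; apply/ffunP => i; apply/val_inj.
by have := e i; rewrite !ffunE.
Qed.

Lemma leq_edeg a i : (a i <= edeg a)%N.
Proof. by rewrite /edeg (bigD1 i) //= leq_addr. Qed.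

Lemma edegD a (b : expo I) : edeg (a + b) = (edeg a + edeg b)%N.
Proof. by rewrite /edeg -big_split; apply: eq_bigr => i _; rewrite ffunE. Qed.

Lemma bvalP d a : reflect (exists b : bexpo I d, bval b = a) [forall i, a i <= d]%N.
Proof.
apply: (iffP forallP) => [le_ad|[b <-] i]; last by rewrite ffunE -ltnS.
exists [ffun i => inord (a i)]; apply/ffunP => i.
by rewrite !ffunE inordK // ltnS.
Qed.

Lemma bval_edeg d a : (edeg a <= d)%N -> exists b : bexpo I d, bval b = a.
Proof.
move=> le_ad; apply/bvalP/forallP => i.
exact: leq_trans (leq_edeg a i) le_ad.
Qed.

Lemma bsum_widen d d' (P : pred (expo I)) (F : expo I -> R) : (d <= d')%N ->
    (forall a, P a -> (edeg a <= d)%N) ->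
  \sum_(b : bexpo I d | P (bval b)) F (bval b) =
  \sum_(b : bexpo I d' | P (bval b)) F (bval b).
Proof.
move=> le_dd' degP.
have mapE k : \sum_(b : bexpo I k | P (bval b)) F (bval b) =
    \sum_(a <- [seq a <- [seq bval b | b : bexpo I k] | P a]) F a.
  by rewrite big_filter big_map big_enum_cond.
rewrite !mapE; apply/perm_big/uniq_perm.
- by rewrite filter_uniq // map_inj_uniq ?enum_uniq //; exact: bval_inj.
- by rewrite filter_uniq // map_inj_uniq ?enum_uniq //; exact: bval_inj.
move=> a; rewrite !mem_filter; case Pa: (P a) => //=.
have [b eb] := bval_edeg (degP _ Pa).
have [b' eb'] := bval_edeg (leq_trans (degP _ Pa) le_dd').
by rewrite -{1}eb -{1}eb' !(map_f, mem_enum).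
Qed.

Lemma bsum_delta d a (F : expo I -> R) : (edeg a <= d)%N ->
  \sum_(b : bexpo I d | bval b == a) F (bval b) = F a.
Proof.
case/bval_edeg => b0 e; rewrite (bigD1 b0) ?e //= big1 ?addr0 // => b.
by rewrite -e => /andP[/eqP/bval_inj-> /eqP].
Qed.

End BoundedSums.

Section Ring.
Variables (I : finType) (R : comNzRingType).
Implicit Types (f g h : fps I R) (a : expo I).

Definition fps0 : fps I R := Fps (fun=> 0).
Definition fps_opp f : fps I R := Fps (fun a => - coef f a).
Definition fps_add f g : fps I R := Fps (fun a => coef f a + coef g a).

Fact fps_addA : associative fps_add.
Proof. by move=> f g h; apply: fpsP => a; apply: addrA. Qed.
Fact fps_addC : commutative fps_add.
Proof. by move=> f g; apply: fpsP => a; apply: addrC. Qed.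
Fact fps_add0 : left_id fps0 fps_add.
Proof. by move=> f; apply: fpsP => a; apply: add0r. Qed.
Fact fps_addN : left_inverse fps0 fps_opp fps_add.
Proof. by move=> f; apply: fpsP => a; apply: addNr. Qed.

HB.instance Definition _ :=
  GRing.isZmodule.Build (fps I R) fps_addA fps_addC fps_add0 fps_addN.

Definition fpsC (c : R) : fps I R := Fps (fun a => if a == 0 then c else 0).

Definition fps_mul f g : fps I R := Fps (fun a =>
  \sum_(b : bexpo I (edeg a)) \sum_(c : bexpo I (edeg a) | bval b + bval c == a)
    coef f (bval b) * coef g (bval c)).

Lemma coef_fps_mul d f g a : (edeg a <= d)%N ->
  coef (fps_mul f g) a =
  \sum_(b : bexpo I d) \sum_(c : bexpo I d | bval b + bval c == a)
    coef f (bval b) * coef g (bval c).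
Proof.
move=> le_ad /=.
pose G k (b : expo I) : R := \sum_(c : bexpo I k | b + bval c == a)
    coef f b * coef g (bval c).
have G0 k b : ~~ (edeg b <= edeg a)%N -> G k b = 0.
  move=> nle; apply: big1 => c /eqP e; move: nle.
  by rewrite -e edegD leq_addr.
rewrite (eq_bigr (fun b => G d (bval b))) => [|b _]; last first.
  apply: (bsum_widen (P := fun c : expo I => bval b + c == a)
    (fun c => coef f (bval b) * coef g c) le_ad) => c /eqP <-.
  by rewrite edegD leq_addl.
rewrite [RHS](eq_bigr (fun b => G d (bval b))) //.
pose P (b : expo I) := (edeg b <= edeg a)%N.
rewrite (bigID (fun b => P (bval b))) [in RHS](bigID (fun b => P (bval b))) /=.
congr (_ + _); first exact: (bsum_widen (P := P)).
by rewrite !big1 // => b /G0->.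
Qed.

Fact fps_mulC : commutative fps_mul.
Proof.
move=> f g; apply: fpsP => a /=; rewrite (exchange_big_dep xpredT) //=.
apply: eq_bigr => b _; apply: eq_big => [c|c _]; first by rewrite addrC.
exact: mulrC.
Qed.

Fact fps_mulA : associative fps_mul.
Proof.
have mul3E f g h a d : d = edeg a -> coef (fps_mul (fps_mul f g) h) a =
    \sum_(b1 : bexpo I d) \sum_(b2 : bexpo I d)
    \sum_(b3 : bexpo I d | bval b1 + bval b2 + bval b3 == a)
      coef f (bval b1) * coef g (bval b2) * coef h (bval b3).
  move=> def_d; have le_ad : (edeg a <= d)%N by rewrite def_d.
  rewrite (coef_fps_mul _ _ le_ad).
  pose T b1 b2 b3 := coef f b1 * coef g b2 * coef h b3.
  pose S := \sum_(b : bexpo I d) \sum_(c : bexpo I d | bval b + bval c == a)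
      \sum_(b1 : bexpo I d) \sum_(b2 : bexpo I d | bval b == bval b1 + bval b2)
        T (bval b1) (bval b2) (bval c).
  transitivity S.
    apply: eq_bigr => b _; apply: eq_bigr => c /eqP e.
    have le_bd : (edeg (bval b) <= d)%N by apply: leq_trans le_ad; rewrite -e edegD leq_addr.
    rewrite (coef_fps_mul _ _ le_bd) mulr_suml; apply: eq_bigr => b1 _.
    by rewrite mulr_suml; apply: eq_bigl => b2; rewrite eq_sym.
  transitivity (\sum_(b1 : bexpo I d) \sum_(b2 : bexpo I d)
      \sum_(c : bexpo I d)
      \sum_(b : bexpo I d | (bval b == bval b1 + bval b2))
        if bval b + bval c == a then T (bval b1) (bval b2) (bval c) else 0).
    pose U (b c b1 b2 : bexpo I d) : R :=
      if (bval b + bval c == a) && (bval b == bval b1 + bval b2)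
      then T (bval b1) (bval b2) (bval c) else 0.
    transitivity (\sum_b \sum_c \sum_b1 \sum_b2 U b c b1 b2).
      apply: eq_bigr => b _; rewrite big_mkcond; apply: eq_bigr => c _.
      rewrite /U; case: eqP => e /=; last by rewrite !big1 // => *; rewrite big1.
      by apply: eq_bigr => b1 _; rewrite big_mkcond.
    transitivity (\sum_b1 \sum_b2 \sum_c \sum_b U b c b1 b2); last first.
      do 3![apply: eq_bigr => ? _]; rewrite [RHS]big_mkcond; apply: eq_bigr => b _.
      by rewrite /U andbC; case: (bval b == _).
    under eq_bigr => b _ do rewrite exchange_big.
    rewrite exchange_big; apply: eq_bigr => b1 _ /=.
    under eq_bigr => b _ do rewrite exchange_big.
    by rewrite exchange_big; apply: eq_bigr => b2 _; rewrite exchange_big.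
  do 2![apply: eq_bigr => ? _]; rewrite [RHS]big_mkcond; apply: eq_bigr => c _.
  rewrite -big_mkcondr /=.
  set s := bval _ + bval _.
  case: eqP => e.
    rewrite (eq_bigl (fun b => bval b == s)) => [|b]; last first.
      by case: eqP => // ->; rewrite e eqxx.
    by rewrite (bsum_delta (fun=> _)) //; apply: leq_trans le_ad;
      rewrite -e edegD leq_addr.
  by rewrite big_pred0 // => b; case: eqP => // -> /=; apply/eqP.
move=> f g h; rewrite [LHS]fps_mulC; apply: fpsP => a.
rewrite !(mul3E _ _ _ _ _ erefl).
under eq_bigr => b _ do under eq_bigr => c _ do rewrite big_mkcond.
under [RHS]eq_bigr => b _ do under eq_bigr => c _ do rewrite big_mkcond.
rewrite [RHS]exchange_big; apply: eq_bigr => b _ /=.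
rewrite [RHS]exchange_big /=; apply: eq_bigr => c _; apply: eq_bigr => e _.
have -> : bval b + bval c + bval e = bval e + bval b + bval c.
  by rewrite [LHS]addrC addrA.
by rewrite [_ * coef f _]mulrC mulrA.
Qed.

Fact fps_mul1 : left_id (fpsC 1) fps_mul.
Proof.
move=> f; apply: fpsP => a /=; set d := edeg a.
have [z z0] : exists z : bexpo I d, bval z = 0.
  by apply/bvalP/forallP => i; rewrite ffunE.
rewrite (bigD1 z) //= [X in _ + X]big1 ?addr0 => [|b ne_bz]; last first.
  apply: big1 => c _; case: eqP => [b0|]; last by rewrite mul0r.
  by case/eqP: ne_bz; apply: bval_inj; rewrite z0.
rewrite z0 eqxx; under eq_bigl => c do rewrite add0r.
by under eq_bigr do rewrite mul1r; rewrite bsum_delta.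
Qed.

Fact fps_mulDl : left_distributive fps_mul fps_add.
Proof.
move=> f g h; apply: fpsP => a /=; rewrite -big_split; apply: eq_bigr => b _ /=.
by rewrite -big_split; apply: eq_bigr => c _ /=; rewrite mulrDl.
Qed.

Fact fps_1neq0 : fpsC 1 != 0 :> fps I R.
Proof.
apply/eqP => /(congr1 (fun f => coef f 0)) /=; rewrite eqxx.
by apply/eqP; rewrite oner_eq0.
Qed.

HB.instance Definition _ := GRing.Zmodule_isComNzRing.Build (fps I R)
  fps_mulA fps_mulC fps_mul1 fps_mulDl fps_1neq0.

End Ring.

Section Substitution.
Variable R : comNzRingType.

Definition fpsX (I : finType) (i : I) : fps I R :=
  Fps (fun a => if a == edelta i then 1 else 0).

(* If the g i have no constant term, then the product of the (g i) ^+ (b i) only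
   has terms of degree at least edeg b, so the exponents b which do not belong to
   bexpo I (edeg a) contribute nothing to the coefficient at a.  Substitution is
   only used for such g. *)
Definition fps_subst (I J : finType) (f : fps I R) (g : I -> fps J R) : fps J R :=
  Fps (fun a => \sum_(b : bexpo I (edeg a))
                  coef f (bval b) * coef (\prod_i g i ^+ bval b i) a).

Definition fps_order_ge (I : finType) (d : nat) (f : fps I R) : Prop :=
  forall a, (edeg a < d)%N -> coef f a = 0.

Lemma fps_order_geM (I : finType) (d e : nat) (f g : fps I R) :
  fps_order_ge d f -> fps_order_ge e g -> fps_order_ge (d + e) (f * g).
Proof.
move=> f0 g0 a lt_a /=; apply: big1 => b _; apply: big1 => c /eqP bc.
have [/f0->|le_db] := ltnP (edeg (bval b)) d; first by rewrite mul0r.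
rewrite [X in _ * X]g0 ?mulr0 //.
rewrite -(ltn_add2l d) (leq_ltn_trans _ lt_a) //.
by apply: leq_trans (eq_leq (congr1 (@edeg I) bc)); rewrite edegD leq_add2r.
Qed.

Lemma fps_order_ge_prod (I J : finType) (g : I -> fps J R) (b : expo I) :
  (forall i, coef (g i) 0 = 0) -> fps_order_ge (edeg b) (\prod_i g i ^+ b i).
Proof.
move=> g0; have g1 i : fps_order_ge 1 (g i).
  move=> a; rewrite ltnS leqn0 sum_nat_eq0 => /forallP a0.
  suff -> : a = 0 by exact: g0.
  by apply/ffunP => j; rewrite ffunE; apply/eqP/(implyP (a0 j)).
rewrite /edeg.
apply: (big_ind2 (fun x d => fps_order_ge d x)) => [a //|x dx y dy|i _].
  exact: fps_order_geM.
elim: (b i) => [a //|k IHk].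
by rewrite exprS -add1n; apply: fps_order_geM.
Qed.

Lemma coef_fps_subst (I J : finType) (f : fps I R) (g : I -> fps J R) d a :
    (forall i, coef (g i) 0 = 0) -> (edeg a <= d)%N ->
  coef (fps_subst f g) a =
  \sum_(b : bexpo I d) coef f (bval b) * coef (\prod_i g i ^+ bval b i) a.
Proof.
move=> g0 le_ad /=.
pose F (b : expo I) := coef f b * coef (\prod_i g i ^+ b i) a.
pose P (b : expo I) := (edeg b <= edeg a)%N.
have F0 b : ~~ P b -> F b = 0.
  by rewrite -ltnNge /F => /(fps_order_ge_prod g0)->; rewrite mulr0.
rewrite (bigID (fun b => P (bval b))) [in RHS](bigID (fun b => P (bval b))) /=.
congr (_ + _); first exact: (bsum_widen (P := P) F).
by rewrite !big1 // => b /F0.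
Qed.

(* The partial derivative at 0. *)
Definition dfps0 (I : finType) (f : fps I R) (i : I) : R := coef f (edelta i).

Definition fps_ideal (I : finType) (f : fps I R) : fps I R -> Prop :=
  fun h => exists g, h = g * f.

Definition same_ideal (I : finType) (f g : fps I R) : Prop :=
  forall h, fps_ideal f h <-> fps_ideal g h.

(* Maps from the space with coordinates indexed by I to the one with coordinates
   indexed by J, given by their components. *)
Definition fmap (I J : finType) : Type := J -> fps I R.

Definition fmap_at0 (I J : finType) (H : fmap I J) : Prop :=
  forall j, coef (H j) 0 = 0.

Definition formal_change_of_coordinates (I J : finType) (Phi : fmap I J) : Prop :=
  fmap_at0 Phi /\
  exists2 Psi : fmap J I, fmap_at0 Psi &
    (forall j, fps_subst (Phi j) Psi = fpsX j) /\
    (forall i, fps_subst (Psi i) Phi = fpsX i).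

End Substitution.

Arguments fpsX {R I} i.

(** * Formal real hypersurfaces

    The coordinates [Z] of C^N are indexed by ['I_N], and [(Z, zeta)] by
    ['I_N + 'I_N]. Normal coordinates [(z, w)] are indexed by [option 'I_N.-1],
    where [None] is the index of [w]; likewise for [(chi, tau)]. *)

Section Hypersurfaces.
Variable R : realType.
Local Notation C := R[i].

Definition fps_conj (I : finType) (f : fps I C) : fps I C :=
  Fps (fun a => conjc (coef f a)).

(* The map (Z, zeta) |-> (H(Z), bar H(zeta)). *)
Definition complexify (I J : finType) (H : fmap C I J) :
    fmap C (I + I)%type (J + J)%type :=
  fun v => match v with
           | inl j => fps_subst (H j) (fun i => fpsX (inl i))
           | inr j => fps_subst (fps_conj (H j)) (fun i => fpsX (inr i))
           end.

Definition swap_vars (I : finType) : fmap C (I + I)%type (I + I)%type :=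
  fun v => match v with inl i => fpsX (inr i) | inr i => fpsX (inl i) end.

Definition formal_real_hypersurface (N : nat) (r : fps ('I_N + 'I_N)%type C) : Prop :=
  [/\ fps_subst (fps_conj r) (@swap_vars 'I_N) = r,
      coef r 0 = 0 &
      exists i : 'I_N, dfps0 r (inl i) != 0].

Section NormalCoordinates.
Variable n : nat.
(* (z, chi, tau) *)
Local Notation zct := ('I_n + option 'I_n)%type.
(* (z, w, chi, tau) *)
Local Notation zwct := (option 'I_n + option 'I_n)%type.

Definition tau : fps zct C := fpsX (inr None).

Definition at_z0 (f : fps zct C) : fps zct C :=
  fps_subst f (fun v => match v with inl _ => 0 | inr _ => fpsX v end).

Definition at_chi0 (f : fps zct C) : fps zct C :=
  fps_subst f (fun v => match v with inr (Some _) => 0 | _ => fpsX v end).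

Definition at_tau0 (f : fps zct C) : fps zct C :=
  fps_subst f (fun v => match v with inr None => 0 | _ => fpsX v end).

(* w - Q(z, chi, tau) *)
Definition graph_equation (Q : fps zct C) : fps zwct C :=
  fpsX (inl None) -
  fps_subst Q (fun v => match v with
                        | inl i => fpsX (inl (Some i))
                        | inr c => fpsX (inr c)
                        end).

Definition infinite_type_form (m : nat) (Q : fps zct C) : Prop :=
  exists Qt : fps zct C,
    [/\ Q = tau + tau ^+ m * Qt, at_chi0 Qt = 0, at_z0 Qt = 0 & at_tau0 Qt <> 0].

End NormalCoordinates.

Section Hypersurface.
Variables (N : nat) (r : fps ('I_N + 'I_N)%type C).

(* Phi is the map (z, w) |-> Z(z, w). *)
Definition normal_coordinates (Phi : fmap C (option 'I_N.-1) 'I_N)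
    (Q : fps ('I_N.-1 + option 'I_N.-1)%type C) : Prop :=
  [/\ formal_change_of_coordinates Phi,
      same_ideal (fps_subst r (complexify Phi)) (graph_equation Q),
      at_z0 Q = tau _ & at_chi0 Q = tau _].

Definition infinite_type (m : nat) : Prop :=
  exists Phi Q, normal_coordinates Phi Q /\ infinite_type_form m Q.

(* A formal complex hypersurface is given, like M, by a generator e of its ideal;
   here this is the hypersurface {w = 0} in normal coordinates. *)
Definition exceptional_hypersurface (e : fps 'I_N C) : Prop :=
  exists Phi Q, normal_coordinates Phi Q /\
    same_ideal (fps_subst e Phi) (fpsX None).

Definition sends_into_itself (H : fmap C 'I_N 'I_N) : Prop :=
  fps_ideal r (fps_subst r (complexify H)).

(* Tangent vectors at 0 are row vectors, and subspaces are row spaces. *)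
Definition T10 : 'M[C]_N := kermx (\col_i dfps0 r (inl i)).

Definition dmap0 (H : fmap C 'I_N 'I_N) : 'M[C]_N := \matrix_(j, i) dfps0 (H i) j.

Definition CR_transversal (H : fmap C 'I_N 'I_N) : Prop :=
  (T10 + dmap0 H :=: 1%:M)%MS.

End Hypersurface.

Definition image_contained (N : nat) (H : fmap C 'I_N 'I_N) (e : fps 'I_N C) : Prop :=
  fps_subst e H = 0.

End Hypersurfaces.

(* Main.v *)
Require Import Defs.
From mathcomp Require Import all_boot all_order all_algebra.
From mathcomp Require Import boolp reals complex ring zify.

(** In normal coordinates let [H = (F, G)] map [w = Q] into itself.  Comparing the
    two sides at [w = Q(z, chi, tau)] gives the reflection identity
    [G(z, Q) = Q(F(z, Q), bar F(chi, tau), bar G(chi, tau))].  At [chi = 0] it says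
    [G = P + P^m a], where [P = p(w)] and [p(w) = bar G(0, w)]: so [G = 0] as soon as
    [p = 0].  Otherwise [p = w^k s(w)] with [s(0) <> 0], and [G], [bar G] both agree
    with [p] up to order [k m] in [w].  The reflection identity then reads
    [p(tau + tau^m Qt) = p(tau)] modulo [tau^(k m)], whereas the difference of the two
    sides has leading term [k s(0) Qt(z, chi, 0) tau^(k + m - 1)]; as [m >= 2], this
    forces [k = 1], that is [G_w(0) <> 0]. *)

Set Implicit Arguments.
Unset Strict Implicit.
Unset Printing Implicit Defensive.

Import Order.TTheory GRing.Theory Num.Theory.

Local Open Scope ring_scope.

(** * Monomials, coefficients of products, cancellation of variables *)

Section Monomials.
Variables (I : finType) (R : comNzRingType).
Implicit Types (f g : fps I R) (a b : expo I) (c : R).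

(** The monomial [c x^b]. By conversion [fpsX i] is [fpsM 1 (edelta i)] and [fpsC I c] is
    [fpsM c 0], so lemmas on monomials apply to both. *)
Definition fpsM c b : fps I R := Fps (fun a => if a == b then c else 0).

Lemma fcoefD f g a : coef (f + g) a = coef f a + coef g a.
Proof. by []. Qed.

Lemma fcoefN f a : coef (- f) a = - coef f a.
Proof. by []. Qed.

Lemma fcoef_sum (T : Type) (s : seq T) (P : pred T) (F : T -> fps I R) a :
  coef (\sum_(i <- s | P i) F i) a = \sum_(i <- s | P i) coef (F i) a.
Proof.
by apply: (big_ind2 (fun f (x : R) => coef f a = x)) => // f x g y <- <-.
Qed.

Lemma expoDI b : injective (+%R b).
Proof.
move=> a a' /ffunP e; apply/ffunP => i.
by have := e i; rewrite !ffunE => /addnI.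
Qed.

Lemma fcoefM_mul c b f a : coef (fpsM c b * f) (b + a) = c * coef f a.
Proof.
have le_b : (edeg b <= edeg (b + a)%R)%N by rewrite edegD leq_addr.
have le_a : (edeg a <= edeg (b + a)%R)%N by rewrite edegD leq_addl.
rewrite (coef_fps_mul _ _ (leqnn _)).
have [b0 e0] := bval_edeg le_b.
rewrite (bigD1 b0) //= [X in _ + X]big1 => [|b1 ne]; last first.
  apply: big1 => c1 _; case: eqP => [e1|]; last by rewrite mul0r.
  by case/eqP: ne; apply: bval_inj; rewrite e0.
rewrite addr0 e0 eqxx.
rewrite (eq_bigl (fun x => bval x == a)); last first.
  by move=> x; rewrite (inj_eq (@expoDI b)).
by rewrite (bsum_delta (fun x => c * coef f x)).
Qed.

Lemma fcoefM_mul0 c b f a :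
  (forall a', a <> b + a') -> coef (fpsM c b * f) a = 0.
Proof.
move=> na; rewrite (coef_fps_mul _ _ (leqnn _)).
apply: big1 => b0 _; apply: big1 => c0 /eqP e /=.
by case: eqP => [e1|]; rewrite ?mul0r //; case: (na (bval c0)); rewrite -e1.
Qed.

Lemma fpsM_mul c b c' b' : fpsM c b * fpsM c' b' = fpsM (c * c') (b + b').
Proof.
apply: fpsP => a; have [[a' ->]|na] := pselect (exists a', a = b + a').
  rewrite fcoefM_mul /= (inj_eq (@expoDI b)).
  by case: ifP; rewrite ?mulr0.
rewrite fcoefM_mul0 /=; last by move=> a' e; apply: na; exists a'.
by case: eqP => // e; case: na; exists b'.
Qed.

Lemma fcoefC_mul c f a : coef (fpsC I c * f) a = c * coef f a.
Proof. by rewrite -[a in LHS]add0r (fcoefM_mul c 0). Qed.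

Lemma fpsC0 : fpsC I 0 = 0 :> fps I R.
Proof. by apply: fpsP => a /=; case: ifP. Qed.

Lemma fcoef0M f g : coef (f * g) 0 = coef f 0 * coef g 0.
Proof.
have e0 : edeg (0 : expo I) = 0%N by apply: big1 => i _; rewrite ffunE.
have z (b : bexpo I 0) : bval b = 0.
  by apply/ffunP => i; rewrite !ffunE; case: (b i) => -[].
have le0 : (edeg (0%R : expo I) <= 0)%N by rewrite e0.
have [b0 _] := bval_edeg le0.
rewrite (coef_fps_mul _ _ le0) (bigD1 b0) //= z.
rewrite [X in _ + X]big1 ?addr0 => [|b1 /eqP []]; last first.
  by apply: bval_inj; rewrite !z.
rewrite (bigD1 b0) ?z ?addr0 //= [X in _ + X]big1 ?addr0 // => b1 /andP [_ /eqP []].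
by apply: bval_inj; rewrite !z.
Qed.

Lemma fpsM_prod b : fpsM 1 b = \prod_i fpsX i ^+ b i.
Proof.
have XE i k : fpsX i ^+ k = fpsM 1 (edelta i *+ k).
  by elim: k => [//|k IH]; rewrite exprS IH -[fpsX i]/(fpsM 1 (edelta i)) fpsM_mul mulr1 mulrS.
have -> : b = \sum_i edelta i *+ b i.
  apply/ffunP => j; rewrite sum_ffunE (bigD1 j) //= big1 => [|i ne].
    by rewrite ffunMnE ffunE eqxx addr0; exact/esym/natn.
  by rewrite ffunMnE ffunE eq_sym (negbTE ne) mul0rn.
rewrite [RHS](eq_bigr (fun i => fpsM 1 (edelta i *+ b i))); last first.
  move=> i _; rewrite -XE; congr (_ ^+ _).
  rewrite sum_ffunE (bigD1 i) //= big1 => [|j ne].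
    by rewrite ffunMnE ffunE eqxx addr0; exact/natn.
  by rewrite ffunMnE ffunE eq_sym (negbTE ne) mul0rn.
by apply: (big_ind2 (fun a f => fpsM 1 a = f)) => // a f a' f' <- <-; rewrite fpsM_mul mulr1.
Qed.

Lemma fps_order_ge1 f : coef f 0 = 0 -> fps_order_ge 1 f.
Proof.
move=> f0 a; rewrite ltnS leqn0 => /eqP a0; suff -> : a = 0 by [].
by apply/ffunP => i; rewrite ffunE; apply/eqP; rewrite -leqn0 -a0 leq_edeg.
Qed.

Lemma fpsX_reg i : injective ( *%R (fpsX i : fps I R)).
Proof.
move=> f g e; apply: fpsP => a.
have := congr1 (fun h => coef h (edelta i + a)) e.
by rewrite (fcoefM_mul 1) (fcoefM_mul 1) !mul1r.
Qed.

Lemma fpsX_expreg i k : injective ( *%R ((fpsX i : fps I R) ^+ k)).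
Proof.
elim: k => [|k IH] f g; first by rewrite !mul1r.
by rewrite exprS -!mulrA => /fpsX_reg /IH.
Qed.

Lemma dfps0XM i f : dfps0 (fpsX i * f) i = coef f 0.
Proof. by rewrite /dfps0 -[edelta i in LHS]addr0 (fcoefM_mul 1) mul1r. Qed.

End Monomials.

(** * Continuous linear operators on power series *)

Section ContinuousLinear.
Variables (I J : finType) (R : comNzRingType).
Implicit Types (phi psi : fps I R -> fps J R).

(** Not lowering the order amounts here to continuity for the topology given by the order. *)
Definition clinear phi :=
  [/\ {morph phi : f g / f + g}, forall c f, phi (fpsC I c * f) = fpsC J c * phi f &
      forall d f, fps_order_ge d f -> fps_order_ge d (phi f)].

(** Reduces identities between series to monomials: up to a remainder of order above [edeg a], which
    cannot affect the coefficient at [a] of either image, a series is a finite combination of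
    monomials. *)
Lemma clinear_ext phi psi : clinear phi -> clinear psi ->
  (forall b, phi (fpsM 1 b) = psi (fpsM 1 b)) -> phi =1 psi.
Proof.
have decomp phi' d f : clinear phi' -> exists2 rest, fps_order_ge d.+1 rest &
    phi' f = \sum_(b : bexpo I d) fpsC J (coef f (bval b)) * phi' (fpsM 1 (bval b)) + phi' rest.
  move=> [phiD phiZ _].
  have phi0 : phi' 0 = 0 by apply: (addIr (phi' 0)); rewrite -phiD !add0r.
  pose pol := \sum_(b : bexpo I d) fpsC I (coef f (bval b)) * fpsM 1 (bval b).
  exists (f - pol).
    move=> a; rewrite ltnS => /bval_edeg[b <-].
    rewrite fcoefD fcoefN fcoef_sum.
    rewrite (bigD1 b) // big1 ?addr0 => [|b' ne].
      by rewrite fcoefC_mul /= eqxx mulr1 addr0 subrr.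
    rewrite fcoefC_mul /= ifF ?mulr0 //; apply/eqP => /bval_inj e.
    by rewrite e eqxx in ne.
  transitivity (phi' (pol + (f - pol))); first by rewrite addrC subrK.
  rewrite [LHS]phiD; congr (_ + _).
  by rewrite (big_morph phi' phiD phi0); apply: eq_bigr => b _; rewrite phiZ.
move=> cphi cpsi e f; apply: fpsP => a.
have [r1 o1 ->] := decomp phi (edeg a) f cphi.
have [r2 o2 ->] := decomp psi (edeg a) f cpsi.
case: cphi cpsi => [_ _ ophi] [_ _ opsi].
rewrite !fcoefD (ophi _ _ o1) // (opsi _ _ o2) // !addr0 !fcoef_sum.
by apply: eq_bigr => b _; rewrite e.
Qed.

End ContinuousLinear.

(** * Substitution as a continuous ring morphism *)

Section Subst.
Variables (I J : finType) (R : comNzRingType) (g : I -> fps J R).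
Hypothesis g0 : fmap_at0 g.
Implicit Types f h : fps I R.

Lemma substD f h : fps_subst (f + h) g = fps_subst f g + fps_subst h g.
Proof.
by apply: fpsP => a /=; rewrite -big_split; apply: eq_bigr => b _; rewrite mulrDl.
Qed.

Lemma subst0 : fps_subst (0 : fps I R) g = 0.
Proof. by apply: fpsP => a /=; apply: big1 => b _; rewrite mul0r. Qed.

Lemma substN f : fps_subst (- f) g = - fps_subst f g.
Proof. by apply: (addrI (fps_subst f g)); rewrite -substD !subrr subst0. Qed.

Lemma substB f h : fps_subst (f - h) g = fps_subst f g - fps_subst h g.
Proof. by rewrite substD substN. Qed.

Lemma substZ c f : fps_subst (fpsC I c * f) g = fpsC J c * fps_subst f g.
Proof.
apply: fpsP => a; rewrite fcoefC_mul [coef (fps_subst f g) a]/= mulr_sumr.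
by apply: eq_bigr => b _; rewrite fcoefC_mul mulrA.
Qed.

Lemma subst_order d f : fps_order_ge d f -> fps_order_ge d (fps_subst f g).
Proof.
move=> of_ a lt_a /=; apply: big1 => b _.
have [/of_->|le_db] := ltnP (edeg (bval b)) d; first by rewrite mul0r.
by rewrite (fps_order_ge_prod g0) ?mulr0 // (leq_trans lt_a).
Qed.

Lemma subst_clinear : clinear (fun f => fps_subst f g).
Proof. by split; [exact: substD | exact: substZ | exact: subst_order]. Qed.

Lemma subst_mono b : fps_subst (fpsM 1 b) g = \prod_i g i ^+ b i.
Proof.
apply: fpsP => a.
(* The sum in the definition stops at [edeg a] and may miss [b]; the larger bound includes it. *)
rewrite (@coef_fps_subst _ _ _ _ _ (edeg a + edeg b)) ?leq_addr //.
have [b0 e0] := bval_edeg (leq_addl (edeg a) (edeg b)).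
rewrite (bigD1 b0) //= [X in _ + X]big1 ?addr0 => [|b1 ne].
  by rewrite e0 eqxx mul1r.
rewrite ifF ?mul0r //; apply/eqP => e.
by case/eqP: ne; apply: bval_inj; rewrite e0.
Qed.

Lemma subst1 : fps_subst (1 : fps I R) g = 1.
Proof.
rewrite -[1 in LHS]/(fpsM 1 0 : fps I R) subst_mono big1 // => i _.
by rewrite ffunE expr0.
Qed.

Lemma substC c : fps_subst (fpsC I c) g = fpsC J c.
Proof. by rewrite -[fpsC I c]mulr1 substZ subst1 mulr1. Qed.

Lemma substX i : fps_subst (fpsX i) g = g i.
Proof.
rewrite -[fpsX i]/(fpsM 1 (edelta i)) subst_mono (bigD1 i) //= big1 ?mulr1 => [|j ne].
  by rewrite ffunE eqxx expr1.
by rewrite ffunE (negbTE ne) expr0.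
Qed.

Lemma mulr_clinearr f : clinear (fun h : fps I R => f * h).
Proof.
split=> [h k|c h|d h oh]; [exact: mulrDr | exact: mulrCA |].
by have /fps_order_geM -/(_ _ _ oh) : fps_order_ge 0 f by [].
Qed.

Lemma clinear_comp (K : finType) (phi : fps I R -> fps J R) (psi : fps J R -> fps K R) :
  clinear phi -> clinear psi -> clinear (psi \o phi).
Proof.
move=> [D Z O] [D' Z' O']; split=> [h k|c h|d h oh] /=.
- by rewrite D D'.
- by rewrite Z Z'.
- exact/O'/O.
Qed.

End Subst.

Section SubstM.
Variables (I J : finType) (R : comNzRingType) (g : I -> fps J R).
Hypothesis g0 : fmap_at0 g.
Implicit Types f h : fps I R.

(** Both sides are continuous and linear in each factor, so two uses of [clinear_ext] leave a
    product of two monomials. *)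
Lemma substM f h : fps_subst (f * h) g = fps_subst f g * fps_subst h g.
Proof.
have c1 f' : clinear (fun h => fps_subst (f' * h) g).
  exact: clinear_comp (mulr_clinearr f') (subst_clinear g0).
have c2 (f' : fps J R) : clinear (fun h => f' * fps_subst h g).
  exact: clinear_comp (subst_clinear g0) (mulr_clinearr f').
apply: (clinear_ext (c1 f) (c2 _)) => b {h}.
rewrite mulrC [RHS]mulrC; apply: (clinear_ext (c1 _) (c2 _)) => b' {f}.
rewrite fpsM_mul mulr1 !subst_mono // -big_split; apply: eq_bigr => i _ /=.
by rewrite ffunE exprD.
Qed.

Lemma substXn f k : fps_subst (f ^+ k) g = fps_subst f g ^+ k.
Proof. by elim: k => [|k IH]; rewrite ?subst1 // !exprS substM IH. Qed.

Lemma subst_prod (T : Type) (s : seq T) (P : pred T) (F : T -> fps I R) :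
  fps_subst (\prod_(i <- s | P i) F i) g = \prod_(i <- s | P i) fps_subst (F i) g.
Proof. by apply: (big_morph (fun f => fps_subst f g)); [exact: substM | exact: subst1]. Qed.

Lemma subst_at0 f : coef (fps_subst f g) 0 = coef f 0.
Proof.
pose f1 := f - fpsC I (coef f 0).
have o1 : fps_order_ge 1 f1.
  by apply: fps_order_ge1; rewrite fcoefD fcoefN /= eqxx subrr.
have e0 : edeg (0 : expo J) = 0%N by apply: big1 => i _; rewrite ffunE.
have e : f = f1 + fpsC I (coef f 0) by rewrite subrK.
by rewrite [in LHS]e substD substC // fcoefD (subst_order g0 o1) ?e0 //= eqxx add0r.
Qed.

End SubstM.

(** * Composition of substitutions and the chain rule at 0 *)

Section SubstComp.
Variables (R : comNzRingType).

Lemma fmap_at0_subst (I J K : finType) (g : I -> fps J R) (h : J -> fps K R) :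
  fmap_at0 g -> fmap_at0 h -> fmap_at0 (fun i => fps_subst (g i) h).
Proof. by move=> g0 h0 i; rewrite subst_at0. Qed.

Lemma substA (I J K : finType) (f : fps I R) (g : I -> fps J R) (h : J -> fps K R) :
  fmap_at0 g -> fmap_at0 h ->
  fps_subst (fps_subst f g) h = fps_subst f (fun i => fps_subst (g i) h).
Proof.
move=> g0 h0; have gh0 := fmap_at0_subst g0 h0.
apply: (clinear_ext (clinear_comp (subst_clinear g0) (subst_clinear h0))
  (subst_clinear gh0)) => b /=.
rewrite !subst_mono // subst_prod //; apply: eq_bigr => i _.
by rewrite substXn.
Qed.

Lemma eq_subst (I J : finType) (f : fps I R) (g g' : I -> fps J R) :
  g =1 g' -> fps_subst f g = fps_subst f g'.
Proof. by move=> /funext ->. Qed.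

Lemma fpsX_at0 (I : finType) (i : I) : coef (fpsX i : fps I R) 0 = 0.
Proof.
rewrite /=; case: eqP => // /ffunP /(_ i).
by rewrite !ffunE eqxx.
Qed.

Lemma subst_id (I : finType) (f : fps I R) : fps_subst f (fun i => fpsX i) = f.
Proof.
have X0 : fmap_at0 (fun i : I => fpsX i : fps I R) by exact: fpsX_at0.
suff: (fun f : fps I R => fps_subst f (fun i => fpsX i)) =1 id by apply.
apply: clinear_ext (subst_clinear X0) _ _ => [|b]; first by split.
by rewrite subst_mono // fpsM_prod.
Qed.

(** Without its terms of degree at most 1, [f] becomes [f1] of order 2; substitution keeps that
    order, so only the linear part of [f] reaches the first derivatives. *)
Lemma dfps0_subst (I J : finType) (f : fps I R) (g : I -> fps J R) j :
  fmap_at0 g -> dfps0 (fps_subst f g) j = \sum_i dfps0 f i * dfps0 (g i) j.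
Proof.
move=> g0; pose f1 := f - fpsC I (coef f 0) - \sum_i fpsC I (dfps0 f i) * fpsX i.
have o1 : fps_order_ge 2 f1.
  move=> a lt_a; rewrite /f1 !fcoefD !fcoefN fcoef_sum.
  have [-> |ne0] := eqVneq a 0.
    rewrite big1 => [|i _]; first by rewrite /= eqxx subrr oppr0 addr0.
    by rewrite fcoefC_mul fpsX_at0 mulr0.
  have [i ai] : exists i, (0 < a i)%N.
    apply/existsP; apply: contraNT ne0 => /existsPn ne; apply/eqP/ffunP => i.
    by rewrite ffunE; apply/eqP; rewrite -leqn0 leqNgt.
  have -> : a = edelta i.
    apply/ffunP => k; rewrite ffunE; case: eqP => [->|/eqP ne].
      by apply/eqP; rewrite eqn_leq ai andbT -ltnS (leq_ltn_trans (leq_edeg a i)).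
    have le : (a i + a k <= edeg a)%N.
      by rewrite /edeg (bigD1 i) //= (bigD1 k) //= addnA leq_addr.
    have := leq_ltn_trans le lt_a; case: (a i) ai => // u _.
    by rewrite addSn !ltnS leqn0 addn_eq0 => /andP[_ /eqP].
  rewrite (bigD1 i) // big1 => [|k ne]; last first.
    rewrite fcoefC_mul /= ifF ?mulr0 //; apply/eqP => /ffunP /(_ i).
    by rewrite !ffunE eqxx eq_sym (negbTE ne).
  rewrite fcoefC_mul /= eqxx mulr1 addr0 ifF ?subr0 ?subrr //.
  by apply/eqP => /ffunP /(_ i); rewrite !ffunE eqxx.
have edge k : edeg (edelta k : expo J) = 1%N.
  rewrite /edeg (bigD1 k) //= ffunE eqxx big1 // => l ne.
  by rewrite ffunE (negbTE ne).
have e : f = f1 + (fpsC I (coef f 0) + \sum_i fpsC I (dfps0 f i) * fpsX i).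
  by rewrite /f1 -(addrA f) -opprD subrK.
clearbody f1; rewrite [in LHS]e !substD substC // /dfps0 !fcoefD.
rewrite (subst_order g0 o1) ?edge // add0r.
rewrite [X in X + _]/= ifF ?add0r; last first.
  by apply/eqP => /ffunP /(_ j); rewrite !ffunE eqxx.
rewrite (big_morph (fun f => fps_subst f g) (substD g) (subst0 g)) fcoef_sum.
by apply: eq_bigr => i _; rewrite substM // substX // substC // fcoefC_mul.
Qed.

End SubstComp.

(** * Division by a variable, order and Taylor expansion in one variable *)

Section Split.
Variables (R : comNzRingType).

Definition zero_at (I : finType) (i : I) : fmap R I I :=
  fun j => if j == i then 0 else fpsX j.

Lemma zero_at_at0 (I : finType) (i : I) : fmap_at0 (zero_at i).
Proof. by move=> j; rewrite /zero_at; case: eqP => // _; exact: fpsX_at0. Qed.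

Lemma coef_subst_zero_at (I : finType) (i : I) (f : fps I R) a :
  coef (fps_subst f (zero_at i)) a = if a i == 0%N then coef f a else 0.
Proof.
pose phi (f : fps I R) : fps I R := Fps (fun a => if a i == 0%N then coef f a else 0).
have cphi : clinear phi.
  split=> [g h|c g|d g og].
  - by apply: fpsP => b; rewrite fcoefD /=; case: eqP; rewrite ?addr0.
  - apply: fpsP => b; transitivity (if b i == 0%N then c * coef g b else 0).
      by rewrite -fcoefC_mul.
    by rewrite fcoefC_mul /=; case: ifP; rewrite ?mulr0.
  - by move=> b /og e /=; rewrite e if_same.
suff /(_ f)-> : (fun f => fps_subst f (zero_at i)) =1 phi by [].
apply: clinear_ext (subst_clinear (@zero_at_at0 I i)) cphi _ => b.
rewrite (subst_mono (@zero_at_at0 I i)).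
have [b0|bn0] := eqVneq (b i) 0%N.
  transitivity (fpsM (1 : R) b).
    rewrite fpsM_prod; apply: eq_bigr => j _; rewrite /zero_at.
    by case: eqP => // ->; rewrite b0 !expr0.
  apply: fpsP => c /=; case: (c =P b) => [->|_]; last by rewrite if_same.
  by rewrite b0.
transitivity (0 : fps I R).
  by rewrite (bigD1 i) //= /zero_at eqxx expr0n (negbTE bn0) mul0r.
apply: fpsP => c /=; case: (c =P b) => [->|_]; last by rewrite if_same.
by rewrite (negbTE bn0).
Qed.

Lemma fps_split (I : finType) (i : I) (f : fps I R) :
  exists q, f = fps_subst f (zero_at i) + fpsX i * q.
Proof.
exists (Fps (fun a => coef f (edelta i + a))); apply: fpsP => a.
rewrite fcoefD coef_subst_zero_at -[fpsX i]/(fpsM 1 (edelta i)).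
have [ai|ai] := eqVneq (a i) 0%N.
  rewrite fcoefM_mul0 ?addr0 // => a' e.
  by move: ai; rewrite e !ffunE eqxx.
have -> : a = edelta i + [ffun j => (a j - (j == i))%N].
  apply/ffunP => j; rewrite !ffunE.
  by case: eqP => [->|_]; [rewrite subn1; case: (a i) ai | rewrite subn0 add0r].
by rewrite fcoefM_mul add0r mul1r.
Qed.

Lemma fps_divX (I : finType) (i : I) (f : fps I R) :
  fps_subst f (zero_at i) = 0 -> exists q, f = fpsX i * q.
Proof. by move=> f0; have [q e] := fps_split i f; exists q; rewrite e f0 add0r. Qed.

(** Induction on the exponent [d] of some nonzero coefficient: as long as the constant term
    vanishes, the variable factors out and [d] drops by one. *)
Lemma fps1_order (f : fps unit R) : f <> 0 ->
  exists k (s : fps unit R), f = fpsX tt ^+ k * s /\ coef s 0 <> 0.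
Proof.
move=> fn0; have [a fa] : exists a, coef f a <> 0.
  by apply/existsNP => f0; apply: fn0; apply: fpsP.
have [d ed] : exists d, d = a tt by exists (a tt).
elim: d f a ed fa {fn0} => [|d IH] f a ed fa.
  exists 0%N, f; rewrite expr0 mul1r; split=> //.
  by have -> : 0 = a :> expo unit by apply/ffunP => -[]; rewrite ffunE.
have [f0|fn0] := pselect (coef f 0 = 0); last first.
  by exists 0%N, f; rewrite expr0 mul1r.
have [q eq] : exists q, f = fpsX tt * q.
  apply: fps_divX; apply: fpsP => b; rewrite coef_subst_zero_at.
  case: eqP => // b0; rewrite -[RHS]f0; congr (coef f _).
  by apply/ffunP => -[]; rewrite ffunE.
have [||k [s [es s0]]] := IH q [ffun=> d]; first by rewrite ffunE.
  have ea : a = edelta tt + [ffun=> d].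
    by apply/ffunP => -[]; rewrite !ffunE -ed.
  by move: fa; rewrite eq ea (fcoefM_mul 1) mul1r.
by exists k.+1, s; rewrite eq es mulrA -exprS.
Qed.

(** Two independent variables, indexed by [bool], first stand for [x] and [y]; there [fps_split]
    divides by the second one, and [g] then specializes the result. *)
Lemma fps1_taylor (J : finType) (s : fps unit R) (x y : fps J R) :
  coef x 0 = 0 -> coef y 0 = 0 ->
  exists q, fps_subst s (fun=> x + y) = fps_subst s (fun=> x) + y * q.
Proof.
move=> x0 y0; pose g b := if b then x else y.
have g0 : fmap_at0 g by case.
have X0 : fmap_at0 (fun _ : unit => fpsX true + fpsX false : fps bool R).
  by move=> ?; rewrite fcoefD !fpsX_at0 addr0.
have [q e] := fps_split false (fps_subst s (fun=> fpsX true + fpsX false)).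
exists (fps_subst q g).
have z0 := @zero_at_at0 _ false; have T0 : fmap_at0 (fun _ : unit => fpsX true : fps bool R).
  by move=> ?; exact: fpsX_at0.
have e1 : fps_subst (fps_subst s (fun=> fpsX true + fpsX false)) (zero_at false) =
    fps_subst s (fun=> fpsX true : fps bool R).
  rewrite substA //; congr (fps_subst s _); apply: funext => _.
  by rewrite substD !substX // /zero_at /= addr0.
have := congr1 (fun f => fps_subst f g) e.
rewrite e1 substD substM // (substX g0) (substA _ X0 g0) (substA _ T0 g0).
by rewrite (substX g0); under eq_subst do rewrite substD !(substX g0).
Qed.

Lemma subst_zero (I J : finType) (f : fps I R) :
  fps_subst f (fun=> 0 : fps J R) = fpsC J (coef f 0).
Proof.
have z0 : fmap_at0 (fun _ : I => 0 : fps J R) by [].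
have cC : clinear (fun f : fps I R => fpsC J (coef f 0)).
  split=> [g h|c g|[|d] g og] //.
  - by apply: fpsP => a /=; case: ifP; rewrite ?addr0.
  - by apply: fpsP => a; rewrite !fcoefC_mul /=; case: ifP; rewrite ?mulr0.
  - move=> a _ /=; rewrite og ?if_same //.
    by rewrite /edeg big1 // => i _; rewrite ffunE.
apply: (clinear_ext (subst_clinear z0) cC) => b; rewrite subst_mono //=.
case: (0 =P b) => [<-|bn0]; first by rewrite big1 // => i _; rewrite ffunE.
have [i bi] : exists i, b i <> 0%N.
  by apply/existsNP => b0; apply: bn0; apply/ffunP => i; rewrite ffunE b0.
by rewrite (bigD1 i) //= expr0n; move/eqP/negbTE: bi => ->; rewrite mul0r fpsC0.
Qed.

End Split.

Arguments zero_at {R I} i.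

(** * Comparison of orders in one variable *)

Section Order.
Variables (K : numDomainType) (J : finType) (i : J).
Local Notation t := (fpsX i : fps J K).

(* Comparing the coefficients of [t ^+ (k + m - 1)]: on the left the first-order
   variation of [t ^+ k * s t] along [t ^+ m * Qt] contributes [k * s 0 * Qt]. *)
Lemma order_eq1 (m k : nat) (s : fps unit K) (Q Qt c1 c2 : fps J K) :
  (2 <= m)%N -> (0 < k)%N -> coef s 0 <> 0 -> Q = t + t ^+ m * Qt ->
  Q ^+ k * fps_subst s (fun=> Q) + Q ^+ (k * m) * c1 =
    t ^+ k * fps_subst s (fun=> t) + t ^+ (k * m) * c2 ->
  fps_subst Qt (zero_at i) <> 0 -> k = 1%N.
Proof.
move=> m2 k0 s0 eQ e Qt0; have [//|k1] := eqVneq k 1%N; case: Qt0.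
have {k0 k1}k2 : (2 <= k)%N by case: k k0 k1 {e} => [|[]].
(* As [k, m >= 2], [(k - 1) * (m - 1) >= 1], that is [k * m >= k + m]: both error terms have order
   beyond [k + m - 1] in [t]. *)
have [j ej] : exists j, (k * m = k + m + j)%N.
  exists (k * m - (k + m))%N; rewrite subnKC //.
  case: k m k2 m2 {e eQ} => [|[|k]] [|[|m]] // _ _.
  by rewrite !(mulnS, mulSn, addnS, addSn, muln0, mul0n, addn0) !ltnS; lia.
have t0 : coef t 0 = 0 by exact: fpsX_at0.
(* With this [x], [Q = t * (1 + x)], so that every term of the equation contains [t ^+ k]. *)
pose x := t ^+ m.-1 * Qt.
have mE : t ^+ m = t * t ^+ m.-1 by rewrite -exprS prednK // (ltn_trans _ m2).
have eQ1 : Q = t * (1 + x) by rewrite eQ mulrDr mulr1 /x mulrA -mE.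
have h0 : coef (t * x) 0 = 0 by rewrite fcoef0M t0 mul0r.
have [q eq] := fps1_taylor s t0 h0.
have [c ec] : exists c, (1 + x) ^+ k = 1 + k%:R * x + x ^+ 2 * c.
  elim: k {e ej k2} => [|k [c ec]]; first by exists 0; rewrite mul0r mulr0 !addr0.
  exists (k%:R + c * (1 + x)); rewrite exprS ec -natr1; ring.
have eQ2 : Q = t + t * x by rewrite eQ1 mulrDr mulr1.
move: e; rewrite {2}eQ2 eq eQ1 !exprMn ec ej.
set S := fps_subst s _; set d := (1 + x) ^+ _.
(* The exponent is split for cancelling first [t ^+ k], then [t ^+ m.-1]; a factor [t ^+ j.+1]
   survives in the error terms. *)
have -> : (k + m + j)%N = (k + (m.-1 + j.+1))%N by case: (m) m2 => // u _; lia.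
rewrite !exprD -!mulrA -!mulrDr => /fpsX_expreg e.
have {e}/fpsX_expreg : t ^+ m.-1 *
    (Qt * (k%:R * S + x * c * S + t * q * (1 + k%:R * x + x ^+ 2 * c)) + t ^+ j.+1 * (d * c1)) =
    t ^+ m.-1 * (t ^+ j.+1 * c2).
  apply: (addrI S); rewrite -e /x. ring.
have z0 := @zero_at_at0 K J i.
have zt : fps_subst t (zero_at i) = 0 by rewrite substX // /zero_at eqxx.
(* As [m >= 2], [t] still divides [x]. *)
have zx : fps_subst x (zero_at i) = 0.
  rewrite /x substM // substXn // zt expr0n.
  by case: (m) m2 => [|[|u]] // _; rewrite mul0r.
have zS : fps_subst S (zero_at i) = fpsC J (coef s 0).
  have T0 : fmap_at0 (fun _ : unit => t) by move=> ?; exact: fpsX_at0.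
  by rewrite /S (substA _ T0 z0) zt subst_zero.
clearbody d x S.
(* At [t = 0] only [Qt * (k%:R * S)] survives, and [S] becomes the constant [s(0)]. *)
move=> /(congr1 (fun f => fps_subst f (zero_at i))).
rewrite !(substD, substM, substXn) // zt zx zS !(mul0r, mulr0, exprS, addr0).
have -> : fps_subst (k%:R : fps J K) (zero_at i) = fpsC J k%:R.
  rewrite (_ : k%:R = fpsC J k%:R) ?substC //.
  elim: (k) => [|u IH]; rewrite ?fpsC0 // -!natr1 IH.
  by apply: fpsP => a /=; case: ifP; rewrite ?addr0.
(* The factors [k] (in characteristic 0) and [s(0)] are nonzero, so every coefficient of [Qt] at
   [t = 0] vanishes. *)
rewrite mulrC -mulrA => e; apply: fpsP => a.
have := congr1 (fun f => coef f a) e; rewrite !fcoefC_mul => /eqP.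
rewrite !mulf_eq0 pnatr_eq0 => /or3P[/eqP k0|/eqP //|/eqP//].
by rewrite k0 in k2.
Qed.

End Order.

(** * Conjugation of coefficients *)

Section Conj.
Variable R : realType.
Local Notation C := R[i].

Lemma fps_conjD (I : finType) (f g : fps I C) : fps_conj (f + g) = fps_conj f + fps_conj g.
Proof. by apply: fpsP => a /=; rewrite rmorphD. Qed.

Lemma fps_conjM (I : finType) (f g : fps I C) : fps_conj (f * g) = fps_conj f * fps_conj g.
Proof.
apply: fpsP => a /=; rewrite rmorph_sum; apply: eq_bigr => b _.
by rewrite rmorph_sum; apply: eq_bigr => c _; rewrite rmorphM.
Qed.

Lemma fps_conjX (I : finType) (i : I) : fps_conj (fpsX i : fps I C) = fpsX i.
Proof. by apply: fpsP => a /=; case: ifP; rewrite ?conjc1 ?conjc0. Qed.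

Lemma fps_conj1 (I : finType) : fps_conj (1 : fps I C) = 1.
Proof. by apply: fpsP => a /=; case: ifP; rewrite ?conjc1 ?conjc0. Qed.

Lemma fps_conjXn (I : finType) (f : fps I C) k : fps_conj (f ^+ k) = fps_conj f ^+ k.
Proof. by elim: k => [|k IH]; rewrite ?fps_conj1 // !exprS fps_conjM IH. Qed.

Lemma fps_conj_subst (I J : finType) (f : fps I C) (g : I -> fps J C) :
  fps_conj (fps_subst f g) = fps_subst (fps_conj f) (fun i => fps_conj (g i)).
Proof.
apply: fpsP => a /=; rewrite rmorph_sum; apply: eq_bigr => b _.
rewrite rmorphM; congr (_ * _).
rewrite -[LHS]/(coef (fps_conj _) a) (big_morph _ (@fps_conjM J) (@fps_conj1 J)).
by congr (coef _ a); apply: eq_bigr => i _; rewrite fps_conjXn.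
Qed.

Lemma fps_conj_at0 (I : finType) (f : fps I C) : coef f 0 = 0 -> coef (fps_conj f) 0 = 0.
Proof. by move=> /= ->; rewrite conjc0. Qed.

End Conj.

(** * The reflection identity and the dichotomy in normal coordinates *)

Section Reflection.
Variables (R : realType) (n : nat).
Local Notation C := R[i].
Local Notation zw := (option 'I_n).
Local Notation zct := ('I_n + option 'I_n)%type.
Local Notation zwct := (option 'I_n + option 'I_n)%type.
Implicit Types (Q : fps zct C) (T : fmap C zw zw).

Lemma complexify_at0 (I J : finType) (H : fmap C I J) :
  fmap_at0 H -> fmap_at0 (complexify H).
Proof.
move=> H0 [j|j]; rewrite [complexify _ _]/= subst_at0 ?fps_conj_at0 // => i; exact: fpsX_at0.
Qed.

(** Completed by [(chi, tau)], this parametrizes the complexified hypersurface [w = Q] by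
    [(z, chi, tau)]. *)
Definition at_graph Q (i : zw) : fps zct C :=
  if i is Some i then fpsX (inl i) else Q.

Lemma at_graph_at0 Q : coef Q 0 = 0 -> fmap_at0 (at_graph Q).
Proof. by move=> Q0 [i|] //=; exact: fpsX_at0. Qed.

(* The point (F, bar F, bar G) of the source space of Q, where (F, G) is T at x
   and (bar F, bar G) is bar T at y. *)
Definition reflected_point (I : finType) T (x y : zw -> fps I C) (v : zct) : fps I C :=
  match v with
  | inl i => fps_subst (T (Some i)) x
  | inr c => fps_subst (fps_conj (T c)) y
  end.

Lemma reflected_point_at0 (I : finType) T (x y : zw -> fps I C) :
  fmap_at0 T -> fmap_at0 x -> fmap_at0 y -> fmap_at0 (reflected_point T x y).
Proof. by move=> T0 x0 y0 [i|c]; rewrite [reflected_point _ _ _ _]/= subst_at0 // fps_conj_at0. Qed.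

Lemma at_chi0_at0 Q : at_chi0 Q = tau _ _ -> coef Q 0 = 0.
Proof.
move=> /(congr1 (fun f => coef f 0)); rewrite /at_chi0 subst_at0 ?fpsX_at0 //.
by move=> [i|[i|]] //; exact: fpsX_at0.
Qed.

Lemma subst_chi0 (I : finType) Q (g : zct -> fps I C) :
  fmap_at0 g -> (forall i, g (inr (Some i)) = 0) -> at_chi0 Q = tau _ _ ->
  fps_subst Q g = g (inr None).
Proof.
move=> g0 gs eQ; have := congr1 (fun f => fps_subst f g) eQ.
rewrite /tau substX // /at_chi0 substA //; last first.
  by move=> [i|[i|]] //; exact: fpsX_at0.
move=> <-; apply: eq_subst => -[i|[i|]]; rewrite ?substX ?subst0 //.
Qed.

Lemma inr_at0 : fmap_at0 (fun i : zw => fpsX (inr i) : fps zct C).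
Proof. by move=> i; exact: fpsX_at0. Qed.

(** On the graph of [Q1] any multiple of its equation vanishes, which leaves the equation of [Q2] at
    [(T, bar T)]. Source and target may differ, so that changes of normal coordinates are
    covered. *)
Lemma reflection Q1 Q2 T :
  coef Q1 0 = 0 -> fmap_at0 T ->
  fps_ideal (graph_equation Q1) (fps_subst (graph_equation Q2) (complexify T)) ->
  fps_subst (T None) (at_graph Q1) =
    fps_subst Q2 (reflected_point T (at_graph Q1) (fun i => fpsX (inr i))).
Proof.
move=> Q10 T0 [k e].
pose pt (v : zwct) : fps zct C :=
  match v with inl i => at_graph Q1 i | inr c => fpsX (inr c) end.
have pt0 : fmap_at0 pt by move=> [i|c]; [exact: at_graph_at0 | exact: fpsX_at0].
have inj0 : fmap_at0 (fun v : zct => match v with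
    | inl i => fpsX (inl (Some i)) | inr c => fpsX (inr c) end : fps zwct C).
  by move=> [i|c]; exact: fpsX_at0.
have cT0 := complexify_at0 T0.
have ge0 : fps_subst (graph_equation Q1) pt = 0.
  rewrite /graph_equation substB substX // substA // -[X in _ - X](_ : Q1 = _) ?subrr //.
  rewrite -[LHS]subst_id; apply: eq_subst => -[i|c]; by rewrite substX.
have := congr1 (fun f => fps_subst f pt) e.
rewrite substM // ge0 mulr0 /graph_equation substB substX // substA // substB.
have in0 (J : finType) (f : zw -> J) : fmap_at0 (fun i => fpsX (f i) : fps J C).
  by move=> i; exact: fpsX_at0.
rewrite /= substA // substA //; last exact: fmap_at0_subst.
move=> /subr0_eq.
rewrite [X in X = _ -> _](_ : _ = fps_subst (T None) (at_graph Q1)); last first.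
  by apply: eq_subst => i; rewrite substX.
move=> ->; apply: eq_subst => -[i|c]; rewrite substX //= substA //.
  by apply: eq_subst => j; rewrite substX.
by apply: eq_subst => j; rewrite substX.
Qed.

Definition w_axis (I : finType) (w : fps I C) (i : zw) : fps I C :=
  if i is None then w else 0.

Lemma w_axis_at0 (I : finType) (w : fps I C) : coef w 0 = 0 -> fmap_at0 (w_axis w).
Proof. by move=> w0 [i|]. Qed.

Lemma reflection_chi0 Q1 Q2 T :
  at_chi0 Q1 = tau _ _ -> fmap_at0 T ->
  fps_ideal (graph_equation Q1) (fps_subst (graph_equation Q2) (complexify T)) ->
  T None = fps_subst Q2 (reflected_point T (fun i => fpsX i) (w_axis (fpsX None))).
Proof.
move=> eQ1 T0 /(reflection (at_chi0_at0 eQ1) T0) e.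
(* The point [chi = 0], [tau = w]: there [Q1] takes the value [w], so [(z, Q1)] becomes [(z, w)]. *)
pose g (v : zct) : fps zw C := match v with
  | inl i => fpsX (Some i) | inr c => w_axis (fpsX None) c end.
have g0 : fmap_at0 g.
  by move=> [i|c]; [exact: fpsX_at0 | exact/w_axis_at0/fpsX_at0].
have Q10 := at_chi0_at0 eQ1; have Qp := at_graph_at0 Q10.
have gp i : fps_subst (at_graph Q1 i) g = fpsX i.
  by case: i => [i|] /=; [rewrite substX | rewrite (subst_chi0 g0 _ eQ1)].
have := congr1 (fun f => fps_subst f g) e.
rewrite substA // substA //; last exact: reflected_point_at0 inr_at0.
rewrite (eq_subst _ gp) subst_id => ->; apply: eq_subst => -[i|c] /=.
  by rewrite substA //; apply: eq_subst => j; rewrite gp.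
rewrite substA //; last exact: inr_at0.
by apply: eq_subst => j; rewrite substX.
Qed.

(** The map [T] preserves [w = 0]: there [bar T] is evaluated at the origin, so [T None] equals [Q2]
    at a point with [chi = tau = 0], which is 0. *)
Lemma reflection_w0 Q1 Q2 T :
  at_chi0 Q1 = tau _ _ -> at_chi0 Q2 = tau _ _ -> fmap_at0 T ->
  fps_ideal (graph_equation Q1) (fps_subst (graph_equation Q2) (complexify T)) ->
  fps_subst (T None) (zero_at (None : zw)) = 0.
Proof.
move=> eQ1 eQ2 T0 /(reflection_chi0 eQ1 T0) ->.
have X0 : fmap_at0 (fun i : zw => fpsX i : fps zw C) by move=> i; exact: fpsX_at0.
have ax0 := w_axis_at0 (fpsX_at0 C (None : zw)).
have z0 := @zero_at_at0 C zw None.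
have rp0 := reflected_point_at0 T0 X0 ax0.
rewrite substA //.
have e c : fps_subst (fps_subst (fps_conj (T c)) (w_axis (fpsX (None : zw))))
    (zero_at (None : zw)) = 0.
  transitivity (fps_subst (fps_conj (T c)) (fun=> 0 : fps zw C)).
    rewrite substA //; apply: eq_subst => -[i|] /=; first by rewrite subst0.
    by rewrite substX // /zero_at eqxx.
  by rewrite subst_zero fps_conj_at0 // fpsC0.
by rewrite (subst_chi0 (fmap_at0_subst rp0 z0) _ eQ2) => [|i]; exact: e.
Qed.

Lemma zero_or_transversal (m : nat) Q T :
  (2 <= m)%N -> at_chi0 Q = tau _ _ -> infinite_type_form m Q -> fmap_at0 T ->
  fps_ideal (graph_equation Q) (fps_subst (graph_equation Q) (complexify T)) ->
  T None = 0 \/ dfps0 (T None) None <> 0.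
Proof.
move=> m2 eQ [Qt [QE _ _ Qt0]] T0 sT.
have Q0 := at_chi0_at0 eQ.
have QS (I : finType) (g : zct -> fps I C) : fmap_at0 g ->
    fps_subst Q g = g (inr None) + g (inr None) ^+ m * fps_subst Qt g.
  by move=> g0; rewrite QE substD (substM g0) (substXn g0) /tau (substX g0).
have X0 : fmap_at0 (fun i : zw => fpsX i : fps zw C) by move=> i; exact: fpsX_at0.
pose w : fps zw C := fpsX None.
have w0 : coef w 0 = 0 by exact: fpsX_at0.
have ax0 := w_axis_at0 w0.
have ax10 := w_axis_at0 (fpsX_at0 C tt).
have cw0 : fmap_at0 (fun _ : unit => w) by [].
have := reflection_chi0 eQ T0 sT; rewrite QS; last exact: reflected_point_at0.
set a := fps_subst Qt _; rewrite [reflected_point _ _ _ _]/= -/w.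
(* The series [p] of the overview, in a single variable so that its factor [s] below can be
   evaluated at [w], at [tau] and at [Q]. *)
pose p1 := fps_subst (fps_conj (T None)) (w_axis (fpsX tt)).
have wax (f : fps zw C) :
    fps_subst (fps_subst f (w_axis (fpsX tt))) (fun=> w) = fps_subst f (w_axis w).
  by rewrite substA //; apply: eq_subst => -[i|] /=; rewrite ?subst0 ?substX.
rewrite -wax -/p1 => GE.
have [p10|p1n0] := pselect (p1 = 0).
  by left; rewrite GE p10 subst0 expr0n /= gtn_eqF ?mul0r ?addr0 // ltnW.
have [k [s [p1E s0]]] := fps1_order p1n0.
have k0 : (0 < k)%N.
  case: k p1E => // p1E; case: s0; have := congr1 (fun f => coef f 0) p1E.
  by rewrite expr0 mul1r /p1 (subst_at0 ax10) fps_conj_at0.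
have p1w (I : finType) (x : fps I C) : coef x 0 = 0 ->
    fps_subst p1 (fun=> x) = x ^+ k * fps_subst s (fun=> x).
  move=> x0; have xx : fmap_at0 (fun _ : unit => x) by [].
  by rewrite p1E (substM xx) (substXn xx) (substX xx).
rewrite (p1w _ w w0) exprMn -exprM -mulrA in GE.
set sw := fps_subst s (fun=> w) in GE.
have GbE := congr1 (@fps_conj R _) GE.
rewrite fps_conjD !fps_conjM !fps_conjXn fps_conjX -/w in GbE.
have wE : fps_subst w (w_axis w) = w by rewrite (substX ax0).
have swE : fps_subst (fps_conj sw) (w_axis w) = fps_conj sw.
  rewrite /sw fps_conj_subst (_ : (fun _ : unit => fps_conj w) = (fun=> w)); last first.
    by apply: funext => _; rewrite fps_conjX.
  by rewrite (substA _ cw0 ax0); apply: eq_subst => _; rewrite wE.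
(* Conjugating [GE] gives [bar G = w^k bar s(w) + w^(k m) b], while on [z = 0] the series [bar G] is
   [p = w^k s(w)] by definition. Subtracting the restriction to [z = 0] trades [bar s] for [s]. *)
have [c2 Gb] : exists c2, fps_conj (T None) = w ^+ k * sw + w ^+ (k * m) * c2.
  set b := fps_conj sw ^+ m * fps_conj a in GbE.
  exists (b - fps_subst b (w_axis w)).
  have := wax (fps_conj (T None)); rewrite -/p1 (p1w _ w w0) -/sw => ->.
  rewrite GbE substD !(substM ax0) !(substXn ax0) wE swE mulrBr addrA addrAC.
  by rewrite addrK.
set Tq := fps_subst (T None) (at_graph Q).
pose t : fps zct C := fpsX (inr None).
have t0 : coef t 0 = 0 by exact: fpsX_at0.
have Qp := at_graph_at0 Q0.
have := reflection Q0 T0 sT; rewrite QS; last exact: reflected_point_at0 inr_at0.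
rewrite [reflected_point _ _ _ _]/= {1}GE Gb !substD !(substM Qp) !(substM inr_at0).
rewrite !(substXn Qp) !(substXn inr_at0) (substX Qp) (substX inr_at0) -/t.
rewrite /sw (substA _ cw0 Qp) (substA _ cw0 inr_at0).
have [l kmE] : exists l, (k * m)%N = (k + l)%N.
  by exists (k * m - k)%N; rewrite subnKC // leq_pmulr // ltnW.
(* Since [k * m >= k], [bar G] is a multiple of [tau^k]; hence [bar G^m] is one of [tau^(k m)] and
   joins the error term. *)
have absorb (f st c d : fps zct C) :
    f = t ^+ k * st + t ^+ (k * m) * c + (t ^+ k * st + t ^+ (k * m) * c) ^+ m * d ->
    exists c3, f = t ^+ k * st + t ^+ (k * m) * c3.
  move=> ->; exists (c + (st + t ^+ l * c) ^+ m * d).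
  rewrite {2}kmE exprD -[_ * _ * c]mulrA -(mulrDr (t ^+ k)) exprMn -exprM.
  by rewrite -addrA -mulrA -mulrDr.
move=> /absorb [c3].
rewrite (_ : fps_subst s _ = fps_subst s (fun=> Q)); last first.
  by apply: eq_subst => _; rewrite (substX Qp).
rewrite (_ : fps_subst s (fun=> fps_subst w _) = fps_subst s (fun=> t)); last first.
  by apply: eq_subst => _; rewrite (substX inr_at0).
move=> /(order_eq1 m2 k0 s0 QE) k1; right.
rewrite GE k1 ?expr1 => [|Qt00]; last first.
  by apply: Qt0; rewrite -[RHS]Qt00; apply: eq_subst => -[i|[i|]].
(* For [k = 1], [G] is [w] times [s(w)] plus a multiple of [w^(m - 1)]; as [m >= 2], its
   [w]-derivative at 0 is [s(0)]. *)
rewrite mul1n -[in w ^+ m](prednK (ltnW m2)) exprS -mulrA -mulrDr dfps0XM.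
rewrite fcoefD fcoef0M /sw (subst_at0 cw0).
case: (m) m2 => [|[|u]] // _; rewrite -[_.+2.-1]/u.+1 exprS !fcoef0M w0 !mul0r addr0; exact: s0.
Qed.

End Reflection.

(** * First derivatives of variables and products at 0 *)

Section FirstDerivatives.
Variable K : comNzRingType.

Lemma dfps0X (I : finType) (i j : I) : dfps0 (fpsX i : fps I K) j = (j == i)%:R.
Proof.
rewrite /dfps0 /=; have [->|ne] := eqVneq j i; first by rewrite eqxx.
rewrite ifF //; apply/eqP => /ffunP /(_ j).
by rewrite !ffunE eqxx (negbTE ne).
Qed.

Lemma dfps0_mul (I : finType) (f g : fps I K) i :
  coef g 0 = 0 -> dfps0 (f * g) i = coef f 0 * dfps0 g i.
Proof.
move=> /fps_order_ge1 og; pose f1 := f - fpsC I (coef f 0).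
have of1 : fps_order_ge 1 f1 by apply: fps_order_ge1; rewrite fcoefD fcoefN /= eqxx subrr.
rewrite -[f in LHS](subrK (fpsC I (coef f 0))) -/f1 mulrDl /dfps0 fcoefD fcoefC_mul.
rewrite (fps_order_geM of1 og) ?add0r //.
rewrite /edeg (bigD1 i) //= ffunE eqxx big1 // => j ne.
by rewrite ffunE (negbTE ne).
Qed.

End FirstDerivatives.

(** * Complexified maps and their first derivatives *)

Section Coordinates.
Variable R : realType.
Local Notation C := R[i].

Lemma complexify_comp (I J K : finType) (H : fmap C I J) (T : fmap C J K) v :
  fmap_at0 H -> fmap_at0 T ->
  fps_subst (complexify T v) (complexify H) = complexify (fun k => fps_subst (T k) H) v.
Proof.
move=> H0 T0; have cH0 := complexify_at0 H0.
have X0 (S : finType) (f : S -> S + S) : fmap_at0 (fun i => fpsX (f i) : fps _ C).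
  by move=> i; exact: fpsX_at0.
case: v => k; rewrite [complexify _ _]/= [complexify _ _ in RHS]/=.
  rewrite (substA _ (X0 _ _) cH0) (substA _ H0 (X0 _ _)).
  by apply: eq_subst => i; rewrite (substX cH0).
have cjH0 : fmap_at0 (fun i => fps_conj (H i)) by move=> i; rewrite fps_conj_at0.
rewrite fps_conj_subst (substA _ (X0 _ _) cH0) (substA _ cjH0 (X0 _ _)).
by apply: eq_subst => i; rewrite (substX cH0).
Qed.

Lemma subst_complexify_comp (I J K : finType) (f : fps (K + K)%type C)
    (H : fmap C I J) (T : fmap C J K) : fmap_at0 H -> fmap_at0 T ->
  fps_subst (fps_subst f (complexify T)) (complexify H) =
  fps_subst f (complexify (fun k => fps_subst (T k) H)).
Proof.
move=> H0 T0; rewrite (substA _ (complexify_at0 T0) (complexify_at0 H0)).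
by apply: eq_subst => v; rewrite complexify_comp.
Qed.

(** The components [inr] of [complexify H] involve only the conjugate variables and drop out of
    derivatives along [inl i]. *)
Lemma dfps0_complexify (I J : finType) (f : fps (J + J)%type C) (H : fmap C I J) i :
  fmap_at0 H ->
  dfps0 (fps_subst f (complexify H)) (inl i) = \sum_j dfps0 f (inl j) * dfps0 (H j) i.
Proof.
move=> H0; rewrite (dfps0_subst _ _ (complexify_at0 H0)).
have -> (F : J + J -> C) : \sum_v F v = \sum_j F (inl j) + \sum_j F (inr j).
  by rewrite big_sumType.
have X0 (f' : I -> I + I) : fmap_at0 (fun i => fpsX (f' i) : fps _ C).
  by move=> ?; exact: fpsX_at0.
rewrite [X in _ + X]big1 ?addr0 => [|j _]; last first.
  rewrite [complexify _ _]/= (dfps0_subst _ _ (X0 inr)) big1 ?mulr0 // => k _.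
  by rewrite dfps0X mulr0.
apply: eq_bigr => j _; congr (_ * _).
rewrite [complexify _ _]/= (dfps0_subst _ _ (X0 inl)) (bigD1 i) //.
rewrite dfps0X eqxx mulr1 big1 => [|k ne]; first exact: addr0.
by rewrite dfps0X (inj_eq inl_inj) eq_sym (negbTE ne) mulr0.
Qed.

(** Restriction to [chi = 0] keeps the [z]-derivatives of [Q] at 0 and turns [Q] into [tau], so they
    vanish; only the term [w] counts. *)
Lemma dfps0_graph_equation n (Q : fps ('I_n + option 'I_n)%type C) k :
  at_chi0 Q = tau _ _ -> dfps0 (graph_equation Q) (inl k) = (k == None)%:R.
Proof.
move=> eQ; have dQ i : dfps0 Q (inl i) = 0.
  have := congr1 (fun f => dfps0 f (inl i)) eQ.
  rewrite /tau dfps0X [_ == _]/= /at_chi0 dfps0_subst; last first.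
    by move=> [j|[j|]] //; exact: fpsX_at0.
  rewrite (bigD1 (inl i)) // dfps0X eqxx mulr1 big1 => [e|v ne]; first by rewrite -[LHS]addr0 e.
  case: v ne => [j|[j|]] ne; last 2 first.
  - exact: mulr0.
  - by rewrite dfps0X mulr0.
  by rewrite dfps0X eq_sym (negbTE ne) mulr0.
rewrite /graph_equation /dfps0 fcoefD fcoefN.
rewrite -![coef _ (edelta _)]/(dfps0 _ (inl k)) dfps0X dfps0_subst; last first.
  by move=> [j|j]; exact: fpsX_at0.
rewrite big1 ?subr0 => [|[j|j] _]; first by rewrite (inj_eq inl_inj).
  by rewrite dQ mul0r.
by rewrite dfps0X mulr0.
Qed.

End Coordinates.

(** * Passage between the original and normal coordinates *)

Section Transfer.
Variables (R : realType) (N : nat).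
Local Notation C := R[i].
Local Notation zw := (option 'I_N.-1).
Variable r : fps ('I_N + 'I_N)%type C.

Lemma same_idealE (I : finType) (f g : fps I C) : same_ideal f g ->
  (exists u, f = u * g) /\ (exists v, g = v * f).
Proof.
move=> fg; split; first by apply/fg; exists 1; rewrite mul1r.
by apply/(fg g); exists 1; rewrite mul1r.
Qed.

(** Here [T] is [H] read from the coordinates [Phi1] to [Phi2]; for [H] the identity it is a change
    of normal coordinates. *)
Lemma sends_normal_coordinates (Phi1 Phi2 : fmap C zw 'I_N) Q1 Q2
    (H : fmap C 'I_N 'I_N) (T : fmap C zw zw) :
  normal_coordinates r Phi1 Q1 -> normal_coordinates r Phi2 Q2 ->
  fmap_at0 H -> sends_into_itself r H -> fmap_at0 T ->
  (forall j, fps_subst (Phi2 j) T = fps_subst (H j) Phi1) ->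
  fps_ideal (graph_equation Q1) (fps_subst (graph_equation Q2) (complexify T)).
Proof.
move=> [[P10 _] s1 _ _] [[P20 _] s2 _ _] H0 [g sH] T0 e.
have [[u1 e1] _] := same_idealE s1; have [_ [u2 e2]] := same_idealE s2.
rewrite e2 (substM (complexify_at0 T0)) (subst_complexify_comp _ T0 P20).
rewrite (_ : (fun k => fps_subst (Phi2 k) T) = (fun k => fps_subst (H k) Phi1)); last first.
  exact: funext.
rewrite -(subst_complexify_comp _ P10 H0) sH (substM (complexify_at0 P10)) e1.
by rewrite !mulrA; eexists.
Qed.

(** [T10] is the kernel of the linear form [c], and row [j] of [dmap0 H] lies outside this kernel,
    hence completes it to the whole space. *)
Lemma CR_transversalP (H : fmap C 'I_N 'I_N) j :
  \sum_i dfps0 r (inl i) * dfps0 (H i) j <> 0 -> CR_transversal r H.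
Proof.
set a := \sum_i _ => a0; rewrite /CR_transversal /T10.
set c := \col_i _.
have ac : row j (dmap0 H) *m c = a%:M.
  apply/matrixP => i k; rewrite !ord1 !mxE /= mulr1n; apply: eq_bigr => l _.
  by rewrite !mxE mulrC.
(* The projection onto the line of row [j] along the kernel of [c]; thus [1 - L] maps into [T10]. *)
pose L := (a^-1 *: c) *m row j (dmap0 H).
apply/eqmxP; rewrite submx1 /= -(subrK L 1%:M); apply: addmx_sub_adds.
  rewrite sub_kermx mulmxBl mul1mx /L -mulmxA ac -scalemxAl mul_mx_scalar scalerA.
  by rewrite mulVf ?scale1r ?subrr //; apply/eqP.
exact: submx_trans (submxMl _ _) (row_sub _ _).
Qed.

(** If [dr] vanished on the image of [dH], so would the [w]-derivative at 0 of [r] along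
    [H o Phi = Phi o T]; but this is [v(0)] times the [w]-derivative of [T None]. *)
Lemma transversal_normal_coordinates (Phi : fmap C zw 'I_N) Q
    (H : fmap C 'I_N 'I_N) (T : fmap C zw zw) :
  normal_coordinates r Phi Q -> fmap_at0 H -> fmap_at0 T ->
  (forall j, fps_subst (Phi j) T = fps_subst (H j) Phi) ->
  dfps0 (T None) None <> 0 -> CR_transversal r H.
Proof.
move=> [[P0 _] s _ eQ] H0 T0 eT dT.
have [[v ev] [u eu]] := same_idealE s.
have cT0 := complexify_at0 T0; have Q0 := at_chi0_at0 eQ.
have ge0 : coef (graph_equation Q) 0 = 0.
  rewrite /graph_equation fcoefD fcoefN fpsX_at0 subst_at0 ?Q0 ?subrr //.
  by move=> [i|c]; exact: fpsX_at0.
(* The graph equation equals [u * v] times itself and has [w]-derivative 1 at 0, so [v] is a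
   unit. *)
have v0 : coef v 0 <> 0.
  move=> v0; have := congr1 (fun f => dfps0 f (inl None)) eu.
  rewrite ev mulrA dfps0_mul // fcoef0M v0 mulr0 mul0r dfps0_graph_equation //.
  by move/eqP; rewrite oner_eq0.
have [[j dj]|nd] := pselect (exists j, \sum_i dfps0 r (inl i) * dfps0 (H i) j <> 0).
  exact: CR_transversalP dj.
have := congr1 (fun f => dfps0 (fps_subst f (complexify T)) (inl None)) ev.
rewrite (subst_complexify_comp _ T0 P0).
rewrite (_ : (fun k => fps_subst (Phi k) T) = (fun k => fps_subst (H k) Phi)); last first.
  exact: funext.
rewrite -(subst_complexify_comp _ P0 H0) dfps0_complexify // big1 => [|j _]; last first.
  rewrite dfps0_complexify // (_ : \sum_i _ = 0) ?mul0r //.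
  by apply: contrapT => dj; apply: nd; exists j.
have dE : \sum_i dfps0 (graph_equation Q) (inl i) * dfps0 (T i) None = dfps0 (T None) None.
  rewrite (bigD1 None) // dfps0_graph_equation // mul1r big1 => [|i ni].
    exact: addr0.
  by rewrite dfps0_graph_equation // (negbTE ni) mul0r.
rewrite (substM cT0) dfps0_mul ?subst_at0 // dfps0_complexify // dE.
by move/esym/eqP; rewrite mulf_eq0 => /orP[/eqP|/eqP].
Qed.

(** The generator [e] may come from other normal coordinates [Phi0]; the transition map [S]
    preserves [w = 0] by [reflection_w0], so [e] vanishes on [w = 0] in the coordinates [Phi]
    too. *)
Lemma exceptional_hypersurface_w0 (Phi : fmap C zw 'I_N) Q (e : fps 'I_N C) :
  normal_coordinates r Phi Q -> exceptional_hypersurface r e ->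
  exists q, fps_subst e Phi = fpsX None * q.
Proof.
move=> nPQ [Phi0 [Q0 [nPQ0 se]]].
have [[P0 _] _ _ eQ] := nPQ; have [[P00 [Psi0 Ps0 [inv0 _]]] _ _ eQ0] := nPQ0.
pose S : fmap C zw zw := fun k => fps_subst (Psi0 k) Phi.
have S0 : fmap_at0 S by exact: fmap_at0_subst.
have X0 : fmap_at0 (fun i : 'I_N => fpsX i : fps _ C) by move=> i; exact: fpsX_at0.
have PS j : fps_subst (Phi0 j) S = Phi j.
  by rewrite /S -substA // inv0 substX.
have sX : sends_into_itself r (fun i => fpsX i).
  exists 1; rewrite mul1r -[RHS]subst_id; apply: eq_subst => -[i|i] /=.
    by rewrite substX // => ?; exact: fpsX_at0.
  by rewrite fps_conjX substX // => ?; exact: fpsX_at0.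
have sS : fps_ideal (graph_equation Q) (fps_subst (graph_equation Q0) (complexify S)).
  apply: sends_normal_coordinates nPQ nPQ0 X0 sX S0 _ => j.
  by rewrite PS substX.
have [q qE] := fps_divX (reflection_w0 eQ eQ0 S0 sS).
have [[g eg] _] := same_idealE se.
exists (q * fps_subst g S).
rewrite -(eq_subst e PS) -substA // eg (substM S0) (substX S0) qE mulrC.
by rewrite mulrA.
Qed.

End Transfer.

Theorem corollary3p3 (R : realType) (N m : nat)
    (r : fps ('I_N + 'I_N)%type R[i]) (e : fps 'I_N R[i]) :
  formal_real_hypersurface r ->
  infinite_type r m ->
  (2 <= m)%N ->
  exceptional_hypersurface r e ->
  forall H : fmap R[i] 'I_N 'I_N,
    fmap_at0 H ->
    sends_into_itself r H ->
    CR_transversal r H \/ image_contained H e.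
Proof.
move=> _ [Phi [Q [nPQ mQ]]] m2 exc H H0 sH.
have [[P0 [Psi Ps0 [PhiK PsiK]]] _ _ eQ] := nPQ.
(* The map [H] in normal coordinates, [Psi o H o Phi]. *)
pose T : fmap R[i] _ _ := fun k => fps_subst (fps_subst (Psi k) H) Phi.
have T0 : fmap_at0 T by exact: fmap_at0_subst (fmap_at0_subst Ps0 H0) P0.
have PT j : fps_subst (Phi j) T = fps_subst (H j) Phi.
  rewrite /T -(substA _ (fmap_at0_subst Ps0 H0) P0) -(substA _ Ps0 H0) PhiK.
  by rewrite (substX H0).
have sT := sends_normal_coordinates nPQ nPQ H0 sH T0 PT.
have [TN|dT] := zero_or_transversal m2 eQ mQ T0 sT; last first.
  by left; exact: transversal_normal_coordinates nPQ H0 T0 PT dT.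
have [q qE] := exceptional_hypersurface_w0 nPQ exc.
(* [e o H o Phi = e o Phi o T], and [e o Phi] is a multiple of [w], which [T] sends to [T None = 0].
   Composing with [Psi] then removes [Phi]. *)
have eHP : fps_subst (fps_subst e H) Phi = 0.
  rewrite (substA _ H0 P0) -(eq_subst e PT) -(substA _ P0 T0) qE (substM T0).
  by rewrite (substX T0) TN mul0r.
right; rewrite /image_contained -(subst_id (fps_subst e H)).
by rewrite -(eq_subst _ PhiK) -(substA _ P0 Ps0) eHP subst0.
Qed.
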